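(* For every $n\in\mathbb{N}$, the tuple $(\stackrel{n}{\mathbb{N}},F_{n},F_{n+1})$ (with $F_n$ as addition and $F_{n+1}$ as multiplication) is a commutative semiring.
   Context: $\mathbb{N}=\{0,1,2,\dots\}$ with successor function $S$ and its inverse $S^{-1}:\mathbb{N}\setminus\{0\}\to\mathbb{N}$. The regular hyperoperations $H_n:\mathbb{N}^2\to\mathbb{N}$, $n\in\mathbb{N}$, are defined recursively by: $H_0(a,b)=S(b)$; $H_1(a,0)=a$; $H_2(a,0)=0$; $H_n(a,0)=1$ for $n\ge 3$; and $H_n(a,b)=H_{n-1}(a,H_n(a,S^{-1}(b)))$ for $n\geq 1$, $b\neq 0$. (So $H_1,H_2,H_3$ are ordinary addition, multiplication, exponentiation.) Fix a base $w_0\in\mathbb{N}\setminus\{0,1\}$. Define $E:\mathbb{N}\to\mathbb{N}$, $E(a)=H_3(w_0,a)$, and let $L:E(\mathbb{N})\to\mathbb{N}$ be its inverse. Put $\stackrel{0}{\mathbb{N}}=\mathbb{N}$ and $\stackrel{n+1}{\mathbb{N}}=E(\stackrel{n}{\mathbb{N}})$ for $n\in\mathbb{N}$; one has $\stackrel{n+1}{\mathbb{N}}\subset\stackrel{n}{\mathbb{N}}$. Commutative hyperoperations: $F_0(a,b)=H_1(a,b)$ and $F_1(a,b)=H_2(a,b)$ for $a,b\in\mathbb{N}$. For $n\ge 2$, $F_n:(\stackrel{n-1}{\mathbb{N}})^2\to\stackrel{n-1}{\mathbb{N}}$ is defined recursively by $F_2(a,b)=E(H_2(L(a),L(b)))$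 and $F_n(a,b)=E(F_{n-1}(L(a),L(b)))$ for $n\geq 3$. When used on $\stackrel{n}{\mathbb{N}}\subset\stackrel{n-1}{\mathbb{N}}$, $F_n$ denotes its restriction. *)

(* Defs.v *)
From HB Require Import structures.
From mathcomp Require Import all_boot all_algebra.
From mathcomp Require Import all_classical.

Set Implicit Arguments.
Unset Strict Implicit.
Unset Printing Implicit Defensive.

Local Open Scope classical_set_scope.

(* The inner recursion is on b; hyper m.+1 a 0 is a, 0, 1, 1, ... for
   m = 0, 1, 2, 3, ... *)
Fixpoint hyper (n a : nat) : nat -> nat :=
  if n is m.+1 then
    fix hyper_n (b : nat) : nat :=
      if b is b'.+1 then hyper m a (hyper_n b')
      else match m with 0 => a | 1 => 0 | _ => 1 end
  else fun b => b.+1.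

Definition E (w0 a : nat) : nat := hyper 3 w0 a.

(* Only the values on range (E w0) matter; elsewhere L returns the dummy 0. *)
Definition L (w0 : nat) : nat -> nat := 'pinv_(fun=> 0) setT (E w0).

Fixpoint level (w0 n : nat) : set nat :=
  if n is m.+1 then E w0 @` level w0 m else setT.

(* For n >= 2, F w0 n is meaningful only on level w0 n.-1, where every L is
   applied to an element of range (E w0).  The clause for n = 2 is the case
   m = 1 of the last one, since F w0 1 = hyper 2. *)
Fixpoint F (w0 n a b : nat) : nat :=
  match n with
  | 0 => hyper 1 a b
  | 1 => hyper 2 a b
  | m.+1 => E w0 (F w0 m (L w0 a) (L w0 b))
  end.

(* (A, add, mul) is a commutative semiring (with zero and one, 0 = 1 not being
   excluded): the subtype A carries a comPzSemiRingType structure whose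
   operations are the restrictions of add and mul.  In particular A is closed
   under add and mul. *)
Definition is_comSemiRing (U : Type) (A : set U) (add mul : U -> U -> U) : Prop :=
  exists c : GRing.ComPzSemiRing A,
    let R : comPzSemiRingType := GRing.ComPzSemiRing.Pack c in
    forall x y : A,
      val ((x : R) + (y : R) : R)%R = add (val x) (val y) /\
      val ((x : R) * (y : R) : R)%R = mul (val x) (val y).

(* Main.v *)
From HB Require Import structures.
Require Import Defs.
From mathcomp Require Import all_boot.
From mathcomp Require Import all_algebra all_classical.

Set Implicit Arguments.
Unset Strict Implicit.
Unset Printing Implicit Defensive.

(** The [n]-th iterate of [E] is a bijection from the natural numbers onto
    [level w0 n], and it carries [+] to [F w0 n] and [*] to [F w0 n.+1].
    The induction on [n] uses the recursion
    [F w0 n.+1 (E a) (E b) = E (F w0 n a b)], which holds also for [n = 0],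
    where it is the law [w0 ^ a * w0 ^ b = w0 ^ (a + b)]. *)

(** Transport of structure: [f] is a bijection onto its range, so each semiring law there is the
    same law of [R] read through the inverse of [f]. *)
Lemma is_comSemiRing_image (R : comPzSemiRingType) (U : choiceType)
    (A : set U) (add mul : U -> U -> U) (f : R -> U) :
    injective f -> A = range f ->
    (forall x y, f (x + y)%R = add (f x) (f y)) ->
    (forall x y, f (x * y)%R = mul (f x) (f y)) ->
  is_comSemiRing A add mul.
Proof.
move=> f_inj -> fD fM {A}.
(* [q] is [f] with its codomain cut down to the range; its inverse [p] picks preimages by [cid]. *)
pose q x : range f := SigSub (mem_set (imageT f x)).
have q_surj (u : range f) : exists x, f x = val u.
  by have /set_mem[x _ fx] := valP u; exists x.
pose p u := projT1 (cid (q_surj u)).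
have pE u : f (p u) = val u by rewrite /p; case: cid.
have qK : cancel q p by move=> x; apply: f_inj; rewrite pE.
have pK : cancel p q by move=> u; apply: val_inj; rewrite /= pE.
(* Going through [p] and [q] builds closure in; agreement with [add] and [mul] comes at the end from
   [fD] and [fM]. *)
pose addA u v := q (p u + p v)%R; pose mulA u v := q (p u * p v)%R.
have addAA : associative addA by move=> u v w; rewrite /addA !qK GRing.addrA.
have addAC : commutative addA by move=> u v; rewrite /addA GRing.addrC.
have add0A : left_id (q 0%R) addA.
  by move=> u; rewrite /addA qK GRing.add0r pK.
have mulAA : associative mulA by move=> u v w; rewrite /mulA !qK GRing.mulrA.
have mulAC : commutative mulA by move=> u v; rewrite /mulA GRing.mulrC.
have mul1A : left_id (q 1%R) mulA.
  by move=> u; rewrite /mulA qK GRing.mul1r pK.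
have mulADl : left_distributive mulA addA.
  by move=> u v w; rewrite /mulA /addA !qK GRing.mulrDl.
have mul0A : left_zero (q 0%R) mulA.
  by move=> u; rewrite /mulA qK GRing.mul0r.
pose N : nmodType := HB.pack {u | u \in range f}
  (GRing.isNmodule.Build {u | u \in range f} addAA addAC add0A).
pose S : comPzSemiRingType := HB.pack {u | u \in range f} N
  (GRing.Nmodule_isComPzSemiRing.Build N mulAA mulAC mul1A mulADl mul0A).
exists (GRing.ComPzSemiRing.class S) => R' u v; split.
- by rewrite -!pE -fD.
- by rewrite -!pE -fM.
Qed.

Lemma hyper1E a b : hyper 1 a b = a + b.
Proof. by elim: b => [|b IHb]; rewrite ?addn0 // addnS -IHb. Qed.

(** Serves to unfold a single step of the recursion while keeping [hyper] folded. *)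
Lemma hyperS n a b : hyper n.+1 a b.+1 = hyper n a (hyper n.+1 a b).
Proof. by []. Qed.

Lemma hyper2E a b : hyper 2 a b = a * b.
Proof.
by elim: b => [|b IHb]; rewrite ?muln0 // hyperS IHb hyper1E mulnS.
Qed.

Lemma EE w0 a : E w0 a = w0 ^ a.
Proof.
by rewrite /E; elim: a => [|a IHa] //; rewrite hyperS IHa hyper2E expnS.
Qed.

Lemma E_inj w0 : 1 < w0 -> injective (E w0).
Proof. by move=> w0_gt1 a b; rewrite !EE => /(expnI w0_gt1). Qed.

Lemma EK w0 : 1 < w0 -> cancel (E w0) (L w0).
Proof.
move=> w0_gt1 a; apply: pinvKV; last by rewrite inE.
by move=> x y _ _; exact: E_inj.
Qed.

Lemma F_E w0 n a b : 1 < w0 -> F w0 n.+1 (E w0 a) (E w0 b) = E w0 (F w0 n a b).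
Proof.
(* From index 2 on, [F] applies [L] to both arguments, and [EK] cancels each [L] against its [E]. *)
move=> w0_gt1; case: n => [|n]; last by rewrite [LHS]/= !EK.
by rewrite [LHS]hyper2E [F _ _ _ _]hyper1E !EE expnD.
Qed.

(** The offset [m] is left free so that one induction serves both operations: [m = 0] is the case of
    [+], [m = 1] that of [*]. *)
Lemma F_iterE w0 n m a b : 1 < w0 ->
  F w0 (n + m) (iter n (E w0) a) (iter n (E w0) b) = iter n (E w0) (F w0 m a b).
Proof.
by move=> w0_gt1; elim: n => // n IHn; rewrite addSn !iterS F_E // IHn.
Qed.

Lemma level_iterE w0 n : level w0 n = range (iter n (E w0)).
Proof.
by elim: n => [|n IHn] /=; rewrite ?image_id // IHn image_comp.
Qed.

Theorem theorem1 (w0 : nat) (w0_neq0 : w0 <> 0) (w0_neq1 : w0 <> 1) (n : nat) :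
  is_comSemiRing (level w0 n) (F w0 n) (F w0 n.+1).
Proof.
have w0_gt1 : 1 < w0 by case: w0 w0_neq0 w0_neq1 => [|[]].
apply: (@is_comSemiRing_image nat nat _ _ _ (iter n (E w0))).
- by elim: n => [|n IHn] a b //= /(E_inj w0_gt1)/IHn.
- exact: level_iterE.
- by move=> a b; rewrite -[n in F _ n]addn0 F_iterE // [F _ _ _ _]hyper1E.
- by move=> a b; rewrite -addn1 F_iterE // [F _ _ _ _]hyper2E.
Qed.
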